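(* Among the five theta constants $\theta[\tfrac15;\tfrac k5]$, $(k=1,3,5,7,9)$, there exist at most three which are algebraically independent over $\mathbb{C}$.
   Context: Let $\mathbb{H}^2=\{\tau\in\mathbb{C}:\Im\tau>0\}$. For $(\epsilon,\epsilon')\in\mathbb{R}^2$, $$\theta[\epsilon;\epsilon'](\zeta,\tau)=\sum_{n\in\mathbb{Z}}\exp\Big(2\pi i\Big[\tfrac12\big(n+\tfrac{\epsilon}{2}\big)^2\tau+\big(n+\tfrac{\epsilon}{2}\big)\big(\zeta+\tfrac{\epsilon'}{2}\big)\Big]\Big),$$ and the theta constant $\theta[\epsilon;\epsilon']=\theta[\epsilon;\epsilon'](0,\tau)$ is regarded as a holomorphic function of $\tau\in\mathbb{H}^2$; algebraic independence is as elements of the field of meromorphic functions on $\mathbb{H}^2$. *)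

(* Defs.v *)
From Stdlib Require Import Reals ZArith List.
From Coquelicot Require Import Coquelicot.
Open Scope R_scope.

Definition Cexp (z : C) : C :=
  (exp (Re z) * cos (Im z), exp (Re z) * sin (Im z)).

Definition theta_term (e e' : R) (tau : C) (n : Z) : C :=
  let m : R := IZR n + e / 2 in
  Cexp (Cmult (Cmult (RtoC (2 * PI)) Ci)
         (Cplus (Cmult (RtoC (/ 2 * m ^ 2)) tau) (RtoC (m * (e' / 2))))).

Definition theta_partial (e e' : R) (tau : C) (N : nat) : C :=
  sum_n (fun j : nat => theta_term e e' tau (Z.of_nat j - Z.of_nat N)%Z) (2 * N).

(** Theta constant theta[e;e'](0,tau) := sum over n in Z (the series converges
    absolutely for Im tau > 0, so the limit of symmetric partial sums is the sum). *)
Definition theta_const (e e' : R) (tau : C) : C :=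
  (real (Lim_seq (fun N => Re (theta_partial e e' tau N))),
   real (Lim_seq (fun N => Im (theta_partial e e' tau N)))).

Definition poly4_eval (d : nat) (c : nat -> nat -> nat -> nat -> C)
  (x1 x2 x3 x4 : C) : C :=
  sum_n (fun a => sum_n (fun b => sum_n (fun g => sum_n (fun h =>
    Cmult (c a b g h)
      (Cmult (Cmult (pow_n x1 a) (pow_n x2 b)) (Cmult (pow_n x3 g) (pow_n x4 h))))
    d) d) d) d.

Definition alg_dependent4 (f1 f2 f3 f4 : C -> C) : Prop :=
  exists (d : nat) (c : nat -> nat -> nat -> nat -> C),
    (exists a b g h, (a <= d)%nat /\ (b <= d)%nat /\ (g <= d)%nat /\ (h <= d)%nat
                     /\ c a b g h <> RtoC 0) /\
    forall tau : C, 0 < Im tau ->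
      poly4_eval d c (f1 tau) (f2 tau) (f3 tau) (f4 tau) = RtoC 0.

(* Main.v *)
Require Import Defs.
From Stdlib Require Import Reals ZArith List Lra Lia Classical.
From Coquelicot Require Import Coquelicot.
Open Scope R_scope.

(** Write y(b) for theta[1/5; b] at a fixed tau. Changing variables to u = n + m, v = n - m in the
    double series for y(a + d) y(a - d) gives A0(a) D0(d) + A1(a) D1(d), one product for each parity
    of u. Hence all 3x3 minors of the matrix (y(a_i + d_j) y(a_i - d_j)) vanish. After removing a
    phase, y has period 2, so for a_i = 2i/5 and d_j = 0, 2/5, 4/5 these minors are polynomials in
    the five theta constants x_0, ..., x_4, with indices mod 5. Two of them are quadratic in x_0, and
    eliminating x_0 leaves an explicit nonzero polynomial of degree 17 in x_1, ..., x_4; cyclic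
    symmetry handles the other choices of four. *)

(** * Symmetric partial sums over the integers: domination, interchange, translation *)

Fixpoint bsum (f : Z -> R) (N : nat) : R :=
  match N with
  | O => f 0%Z
  | S p => bsum f p + (f (Z.of_nat (S p)) + f (- Z.of_nat (S p))%Z)
  end.

Lemma bsum_ext f g N : (forall n, f n = g n) -> bsum f N = bsum g N.
Proof. intros H; induction N as [|N IH]; cbn [bsum]; rewrite ?IH, !H; reflexivity. Qed.

Lemma bsum_plus f g N : bsum (fun n => f n + g n) N = bsum f N + bsum g N.
Proof. induction N as [|N IH]; cbn [bsum]; rewrite ?IH; ring. Qed.

Lemma bsum_scal c f N : bsum (fun n => c * f n) N = c * bsum f N.
Proof. induction N as [|N IH]; cbn [bsum]; rewrite ?IH; ring. Qed.

Lemma bsum_le f g N : (forall n, f n <= g n) -> bsum f N <= bsum g N.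
Proof.
  intros H; induction N as [|N IH]; cbn [bsum]; [apply H|].
  generalize (H (Z.of_nat (S N))) (H (- Z.of_nat (S N))%Z); lra.
Qed.

Lemma bsum_Rabs f N : Rabs (bsum f N) <= bsum (fun n => Rabs (f n)) N.
Proof.
  induction N as [|N IH]; cbn [bsum]; [lra|].
  eapply Rle_trans; [apply Rabs_triang|]; apply Rplus_le_compat; [exact IH|].
  apply Rabs_triang.
Qed.

Lemma bsum_opp f N : bsum (fun n => f (- n)%Z) N = bsum f N.
Proof.
  induction N as [|N IH]; cbn [bsum]; [reflexivity|].
  rewrite IH, Z.opp_involutive; ring.
Qed.

Lemma bsum_switch (F : Z -> Z -> R) M N :
  bsum (fun n => bsum (F n) N) M = bsum (fun u => bsum (fun n => F n u) M) N.
Proof.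
  induction M as [|M IH]; cbn [bsum]; [reflexivity|].
  rewrite IH, !bsum_plus; reflexivity.
Qed.

Lemma bsum_diff_le f g K N : (forall n, Rabs (f n) <= g n) -> (K <= N)%nat ->
  Rabs (bsum f N - bsum f K) <= bsum g N - bsum g K.
Proof.
  intros H; induction 1 as [|N _ IH].
  - rewrite !Rminus_diag, Rabs_R0; lra.
  - cbn [bsum].
    generalize (H (Z.of_nat (S N))) (H (- Z.of_nat (S N))%Z).
    set (p := f _); set (q := f (- _)%Z).
    replace (_ - bsum f K) with (bsum f N - bsum f K + (p + q)) by ring.
    intros Hp Hq.
    generalize (Rabs_triang (bsum f N - bsum f K) (p + q)) (Rabs_triang p q); lra.
Qed.

Definition bounded_bsum (g : Z -> R) : Prop := exists B, forall N, bsum g N <= B.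

Lemma bounded_bsum_le f g :
  (forall n, f n <= g n) -> bounded_bsum g -> bounded_bsum f.
Proof.
  intros H [B HB]; exists B; intros N.
  eapply Rle_trans; [apply bsum_le, H|apply HB].
Qed.

Lemma bounded_bsum_scal c g : 0 <= c -> bounded_bsum g -> bounded_bsum (fun n => c * g n).
Proof.
  intros Hc [B HB]; exists (c * B); intros N.
  rewrite bsum_scal; apply Rmult_le_compat_l; auto.
Qed.

Lemma bsum_nonneg_cvg g : (forall n, 0 <= g n) -> bounded_bsum g ->
  ex_finite_lim_seq (bsum g).
Proof.
  intros H [B HB]; apply ex_finite_lim_seq_incr with B; [|exact HB].
  intros N; cbn [bsum].
  generalize (H (Z.of_nat (S N))) (H (- Z.of_nat (S N))%Z); lra.
Qed.

(** Since [f = (f + g) - g], the series is a difference of two series with nonnegative terms and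
    bounded partial sums. *)
Lemma bsum_abs_cvg f g : (forall n, Rabs (f n) <= g n) -> bounded_bsum g ->
  ex_finite_lim_seq (bsum f).
Proof.
  intros H Hg.
  assert (H0 : forall n, - g n <= f n <= g n) by (intros n; apply Rabs_le_between, H).
  destruct (bsum_nonneg_cvg g) as [l1 H1]; [|exact Hg|].
  { intros n; generalize (H0 n); lra. }
  destruct (bsum_nonneg_cvg (fun n => f n + g n)) as [l2 H2].
  { intros n; generalize (H0 n); lra. }
  { apply bounded_bsum_le with (fun n => 2 * g n).
    - intros n; generalize (H0 n); lra.
    - apply bounded_bsum_scal; [lra|exact Hg]. }
  exists (l2 - l1).
  apply is_lim_seq_ext with (fun N => bsum (fun n => f n + g n) N - bsum g N).
  - intros N; rewrite bsum_plus; ring.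
  - now apply is_lim_seq_minus'.
Qed.

Lemma bsum_cvg_pointwise (x : nat -> Z -> R) (y : Z -> R) K :
  (forall n, is_lim_seq (fun N => x N n) (y n)) ->
  is_lim_seq (fun N => bsum (x N) K) (bsum y K).
Proof.
  intros H; induction K as [|K IH]; cbn [bsum]; [apply H|].
  repeat apply is_lim_seq_plus'; auto.
Qed.

(** Dominated convergence where terms and truncation vary together: beyond a fixed [K] the tail of
    [g] controls everything, and up to [K] only finitely many terms have to converge. *)
Lemma bsum_tannery (x : nat -> Z -> R) (y g : Z -> R) (l : R) :
  (forall N n, Rabs (x N n) <= g n) -> bounded_bsum g ->
  (forall n, is_lim_seq (fun N => x N n) (y n)) ->
  is_lim_seq (bsum y) l -> is_lim_seq (fun N => bsum (x N) N) l.
Proof.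
  intros Hx Hg Hy Hl.
  assert (Hyg : forall n, Rabs (y n) <= g n).
  { intros n; apply (is_lim_seq_le (fun N => Rabs (x N n)) (fun _ => g n) (Rabs (y n)) (g n));
      [intros N; apply Hx | exact (is_lim_seq_abs _ _ (Hy n)) | apply is_lim_seq_const]. }
  assert (Hg0 : forall n, 0 <= g n).
  { intros n; eapply Rle_trans; [apply Rabs_pos|apply Hyg]. }
  apply is_lim_seq_ext with (fun N => (bsum (x N) N - bsum y N) + bsum y N).
  { intros N; ring. }
  replace l with (0 + l) by ring.
  apply is_lim_seq_plus'; [|exact Hl].
  destruct (bsum_nonneg_cvg g Hg0 Hg) as [G HG].
  apply is_lim_seq_spec in HG.
  apply is_lim_seq_spec; intros eps.
  (* One sixth covers the terms up to [K]. Each of the two tails takes two sixths, because the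
     increment of [bsum g] from [K] to [N] is estimated through its limit [G]. *)
  assert (He : 0 < eps / 6) by (generalize (cond_pos eps); lra).
  destruct (HG (mkposreal _ He)) as [K HK]; cbn [pos] in HK.
  assert (HF := bsum_cvg_pointwise x y K Hy).
  apply is_lim_seq_spec in HF.
  destruct (HF (mkposreal _ He)) as [K' HK']; cbn [pos] in HK'.
  exists (Nat.max K K'); intros N HN.
  assert (H1 := HK' N ltac:(lia)).
  assert (H2 := HK N ltac:(lia)). assert (H3 := HK K ltac:(lia)).
  assert (H4 := bsum_diff_le (x N) g K N (Hx N) ltac:(lia)).
  assert (H5 := bsum_diff_le y g K N Hyg ltac:(lia)).
  apply Rabs_def2 in H1, H2, H3.
  apply Rabs_le_between in H4, H5.
  apply Rabs_def1; lra.
Qed.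

(** Both iterated sums are limits of the same square partial sums, by [bsum_tannery] applied in each
    order of summation. *)
Lemma bsum_fubini (F : Z -> Z -> R) (g h r c : Z -> R) (x y : R) :
  (forall n u, Rabs (F n u) <= g n * h u) ->
  (forall n, 0 <= g n) -> (forall u, 0 <= h u) ->
  bounded_bsum g -> bounded_bsum h ->
  (forall n, is_lim_seq (bsum (F n)) (r n)) ->
  (forall u, is_lim_seq (bsum (fun n => F n u)) (c u)) ->
  is_lim_seq (bsum r) x -> is_lim_seq (bsum c) y -> x = y.
Proof.
  intros HF Hg Hh Bg Bh Hr Hc Hx Hy.
  assert (T1 : is_lim_seq (fun N => bsum (fun n => bsum (F n) N) N) x).
  { destruct Bh as [H HH].
    assert (0 <= H) by (eapply Rle_trans; [apply (Hh 0%Z)|apply (HH 0%nat)]).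
    apply (bsum_tannery (fun N n => bsum (F n) N) r (fun n => H * g n)); auto.
    - intros N n; eapply Rle_trans; [apply bsum_Rabs|].
      eapply Rle_trans; [apply bsum_le with (g := fun u => g n * h u); auto|].
      rewrite bsum_scal, Rmult_comm; apply Rmult_le_compat_r; auto.
    - now apply bounded_bsum_scal. }
  assert (T2 : is_lim_seq (fun N => bsum (fun u => bsum (fun n => F n u) N) N) y).
  { destruct Bg as [H HH].
    assert (0 <= H) by (eapply Rle_trans; [apply (Hg 0%Z)|apply (HH 0%nat)]).
    apply (bsum_tannery (fun N u => bsum (fun n => F n u) N) c (fun n => H * h n)); auto.
    - intros N u; eapply Rle_trans; [apply bsum_Rabs|].
      eapply Rle_trans; [apply bsum_le with (g := fun n => h u * g n)|].
      { intros n; rewrite Rmult_comm; apply HF. }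
      rewrite bsum_scal, Rmult_comm; apply Rmult_le_compat_r; auto.
    - now apply bounded_bsum_scal. }
  apply is_lim_seq_unique in T1.
  rewrite (Lim_seq_ext _ (fun N => bsum (fun u => bsum (fun n => F n u) N) N)) in T1
    by (intros N; apply bsum_switch).
  apply is_lim_seq_unique in T2; congruence.
Qed.

Lemma bsum_succ_shift f N :
  bsum (fun n => f (n + 1)%Z) N = bsum f N + (f (Z.of_nat (S N)) - f (- Z.of_nat N)%Z).
Proof.
  induction N as [|N IH]; cbn [bsum].
  - change (Z.of_nat 1) with 1%Z; cbn; ring.
  - rewrite IH.
    replace (Z.of_nat (S N) + 1)%Z with (Z.of_nat (S (S N))) by lia.
    replace (- Z.of_nat (S N) + 1)%Z with (- Z.of_nat N)%Z by lia.
    ring.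
Qed.

(** The terms are squeezed by the increments of the convergent sequence [bsum g]. *)
Lemma bsum_term_lim f g : (forall n, Rabs (f n) <= g n) -> bounded_bsum g ->
  is_lim_seq (fun N => f (Z.of_nat N)) 0 /\ is_lim_seq (fun N => f (- Z.of_nat N)%Z) 0.
Proof.
  intros H Hg.
  assert (Hg0 : forall n, 0 <= g n).
  { intros n; eapply Rle_trans; [apply Rabs_pos|apply H]. }
  destruct (bsum_nonneg_cvg g Hg0 Hg) as [G HG].
  assert (HD : is_lim_seq (fun N => bsum g (S N) - bsum g N) 0).
  { replace 0 with (G - G) by ring.
    apply is_lim_seq_minus'; [now apply is_lim_seq_incr_1 in HG|exact HG]. }
  split; apply is_lim_seq_incr_1, is_lim_seq_abs_0;
    (apply is_lim_seq_le_le with (2 := is_lim_seq_const 0) (3 := HD);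
     intros N; split; [apply Rabs_pos|]; cbn [bsum];
     generalize (H (Z.of_nat (S N))) (H (- Z.of_nat (S N))%Z)
       (Hg0 (Z.of_nat (S N))) (Hg0 (- Z.of_nat (S N))%Z); lra).
Qed.

Lemma bounded_bsum_shift_succ g : (forall n, 0 <= g n) -> bounded_bsum g ->
  bounded_bsum (fun n => g (n + 1)%Z).
Proof.
  intros H [B HB]; exists B; intros N; rewrite bsum_succ_shift.
  generalize (HB (S N)) (H (- Z.of_nat N)%Z) (H (- Z.of_nat (S N))%Z); cbn [bsum]; lra.
Qed.

(** Symmetric truncation is not translation invariant, but a unit shift changes it only by two
    boundary terms, which tend to 0. The majorant is shifted along in the induction. *)
Lemma bsum_shift_nat (k : nat) : forall f g (l : R), (forall n, Rabs (f n) <= g n) ->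
  bounded_bsum g -> is_lim_seq (bsum f) l ->
  is_lim_seq (bsum (fun n => f (n + Z.of_nat k)%Z)) l.
Proof.
  induction k as [|k IH]; intros f g l H Hg Hl.
  - apply is_lim_seq_ext with (2 := Hl); intros N; apply bsum_ext; intros n.
    f_equal; lia.
  - apply is_lim_seq_ext with (bsum (fun n => f (n + Z.of_nat k + 1)%Z)).
    { intros N; apply bsum_ext; intros n; f_equal; lia. }
    apply (IH (fun n => f (n + 1)%Z) (fun n => g (n + 1)%Z)); [auto| |].
    { apply bounded_bsum_shift_succ; auto.
      intros n; eapply Rle_trans; [apply Rabs_pos|apply H]. }
    apply is_lim_seq_ext
      with (fun N => bsum f N + (f (Z.of_nat (S N)) - f (- Z.of_nat N)%Z)).
    { intros N; now rewrite bsum_succ_shift. }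
    destruct (bsum_term_lim f g H Hg) as [T1 T2].
    apply is_lim_seq_incr_1 in T1.
    replace l with (l + (0 - 0)) by ring.
    apply is_lim_seq_plus'; [exact Hl|now apply is_lim_seq_minus'].
Qed.

Lemma bsum_shift (k : Z) f g (l : R) : (forall n, Rabs (f n) <= g n) ->
  bounded_bsum g -> is_lim_seq (bsum f) l ->
  is_lim_seq (bsum (fun n => f (n + k)%Z)) l.
Proof.
  intros H Hg Hl.
  destruct (Z_le_gt_dec 0 k) as [Hk|Hk].
  - rewrite <- (Z2Nat.id k Hk); now apply bsum_shift_nat with g.
  (* The reflection [n -> -n] turns a negative shift into a positive one. *)
  - apply is_lim_seq_ext with (bsum (fun n => f (- (n + Z.of_nat (Z.to_nat (- k))))%Z)).
    { intros N; rewrite <- bsum_opp; apply bsum_ext; intros n; f_equal; lia. }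
    apply (bsum_shift_nat _ (fun n => f (- n)%Z) (fun n => g (- n)%Z)); [auto| |].
    + destruct Hg as [B HB]; exists B; intros N; rewrite bsum_opp; auto.
    + apply is_lim_seq_ext with (2 := Hl); intros N; now rewrite bsum_opp.
Qed.

(** * Exponential and Gaussian majorants *)

Lemma bounded_bsum_exp a : 0 < a -> bounded_bsum (fun n => exp (- a * Rabs (IZR n))).
Proof.
  intros Ha.
  set (r := exp (- a)).
  assert (Hr : 0 < r < 1).
  { split; [apply exp_pos|]; rewrite <- exp_0; apply exp_increasing; lra. }
  exists (2 / (1 - r)); intros N.
  (* The right-hand side is [2 * (1 + r + ... + r ^ N)]: counting the term at 0 twice gives a closed
     form suited to induction. *)
  enough (H : bsum (fun n => exp (- a * Rabs (IZR n))) N <= 2 / (1 - r) * (1 - r ^ (S N))).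
  { eapply Rle_trans; [exact H|].
    rewrite <- (Rmult_1_r (2 / (1 - r))) at 2.
    apply Rmult_le_compat_l.
    - apply Rlt_le, Rdiv_lt_0_compat; lra.
    - generalize (pow_lt r (S N) (proj1 Hr)); lra. }
  assert (E : forall n : nat, exp (- a * INR n) = r ^ n).
  { induction n as [|n IH].
    - rewrite Rmult_0_r, exp_0; reflexivity.
    - rewrite S_INR, Rmult_plus_distr_l, exp_plus, IH, Rmult_1_r; fold r; simpl; ring. }
  induction N as [|N IH].
  - cbn [bsum]; rewrite Rabs_R0, Rmult_0_r, exp_0, pow_1.
    replace (2 / (1 - r) * (1 - r)) with 2 by (field; lra); lra.
  - cbn [bsum]; rewrite opp_IZR, Rabs_Ropp, <- INR_IZR_INZ.
    rewrite (Rabs_pos_eq (INR (S N))) by apply pos_INR.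
    rewrite E.
    replace (2 / (1 - r) * (1 - r ^ S (S N)))
      with (2 / (1 - r) * (1 - r ^ S N) + 2 * r ^ S N) by (simpl; field; lra).
    lra.
Qed.

Lemma Rabs_IZR_le_sqr n : Rabs (IZR n) <= IZR n ^ 2.
Proof.
  rewrite <- abs_IZR.
  replace (IZR n ^ 2) with (IZR (n * n)) by (rewrite mult_IZR; ring).
  apply IZR_le; nia.
Qed.

Lemma exp_le_compat x y : x <= y -> exp x <= exp y.
Proof. intros [H| ->]; [now apply Rlt_le, exp_increasing|apply Rle_refl]. Qed.

(** From [(x + 2 * s) ^ 2 >= 0] follows [(x + s) ^ 2 >= x ^ 2 / 2 - s ^ 2], and [x ^ 2 >= |x|] for
    integral [x]; this reduces to the exponential majorant. *)
Lemma bounded_bsum_gauss a s : 0 < a ->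
  bounded_bsum (fun n => exp (- a * (IZR n + s) ^ 2)).
Proof.
  intros Ha.
  apply bounded_bsum_le with (fun n => exp (a * s ^ 2) * exp (- (a / 2) * Rabs (IZR n))).
  - intros n; rewrite <- exp_plus; apply exp_le_compat.
    generalize (Rabs_IZR_le_sqr n); set (x := IZR n); intros Hx.
    assert (H0 : 0 <= (x + 2 * s) ^ 2) by apply pow2_ge_0.
    nra.
  - apply bounded_bsum_scal; [apply Rlt_le, exp_pos|].
    apply bounded_bsum_exp; lra.
Qed.

(** * Complex series over the integers *)

Definition is_bsum (f : Z -> C) (l : C) : Prop :=
  is_lim_seq (bsum (fun n => Re (f n))) (Re l) /\
  is_lim_seq (bsum (fun n => Im (f n))) (Im l).

Definition dominated (f : Z -> C) (g : Z -> R) : Prop :=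
  forall n, Rabs (Re (f n)) <= g n /\ Rabs (Im (f n)) <= g n.

Lemma is_bsum_ext f g l : (forall n, f n = g n) -> is_bsum f l -> is_bsum g l.
Proof.
  intros H [H1 H2]; split.
  - apply is_lim_seq_ext with (2 := H1); intros N; apply bsum_ext; intros n; now rewrite H.
  - apply is_lim_seq_ext with (2 := H2); intros N; apply bsum_ext; intros n; now rewrite H.
Qed.

Lemma is_bsum_plus f g l m : is_bsum f l -> is_bsum g m ->
  is_bsum (fun n => Cplus (f n) (g n)) (Cplus l m).
Proof.
  intros [F1 F2] [G1 G2]; split.
  - apply is_lim_seq_ext with (2 := is_lim_seq_plus' _ _ _ _ F1 G1).
    intros N; now rewrite <- bsum_plus.
  - apply is_lim_seq_ext with (2 := is_lim_seq_plus' _ _ _ _ F2 G2).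
    intros N; now rewrite <- bsum_plus.
Qed.

Lemma is_bsum_scal c f l : is_bsum f l -> is_bsum (fun n => Cmult c (f n)) (Cmult c l).
Proof.
  intros [F1 F2]; split.
  - apply is_lim_seq_ext
      with (fun N => Re c * bsum (fun n => Re (f n)) N - Im c * bsum (fun n => Im (f n)) N).
    + intros N; rewrite <- !bsum_scal; unfold Rminus.
      (* The subtracted sum becomes [-1] times a sum, so that [bsum_scal] and [bsum_plus] can merge
         the two. *)
      rewrite <- (Rmult_1_l (bsum (fun n => Im c * _) N)), <- Ropp_mult_distr_l_reverse.
      rewrite <- bsum_scal, <- bsum_plus; apply bsum_ext; intros n; cbn; unfold Re, Im; ring.
    + apply is_lim_seq_minus'.
      * exact (is_lim_seq_scal_l _ (Re c) _ F1).
      * exact (is_lim_seq_scal_l _ (Im c) _ F2).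
  - apply is_lim_seq_ext
      with (fun N => Re c * bsum (fun n => Im (f n)) N + Im c * bsum (fun n => Re (f n)) N).
    + intros N; rewrite <- !bsum_scal, <- bsum_plus; apply bsum_ext; intros n; cbn; unfold Re, Im; ring.
    + apply is_lim_seq_plus'.
      * exact (is_lim_seq_scal_l _ (Re c) _ F2).
      * exact (is_lim_seq_scal_l _ (Im c) _ F1).
Qed.

Lemma is_bsum_unique f l m : is_bsum f l -> is_bsum f m -> l = m.
Proof.
  intros [F1 F2] [G1 G2].
  apply is_lim_seq_unique in F1, F2, G1, G2.
  rewrite F1 in G1; rewrite F2 in G2; injection G1; injection G2.
  destruct l, m; cbn; congruence.
Qed.

(** Total by the conventions of [Lim_seq] and [real], in the same form as [theta_const]; under
    domination it is the actual sum. *)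
Definition btotal (f : Z -> C) : C :=
  (real (Lim_seq (bsum (fun n => Re (f n)))), real (Lim_seq (bsum (fun n => Im (f n))))).

Lemma dominated_is_bsum f g : dominated f g -> bounded_bsum g -> is_bsum f (btotal f).
Proof.
  intros H Hg; split; apply Lim_seq_correct'.
  - exact (bsum_abs_cvg (fun n => Re (f n)) g (fun n => proj1 (H n)) Hg).
  - exact (bsum_abs_cvg (fun n => Im (f n)) g (fun n => proj2 (H n)) Hg).
Qed.

Lemma is_bsum_shift (k : Z) f g l : dominated f g -> bounded_bsum g ->
  is_bsum f l -> is_bsum (fun n => f (n + k)%Z) l.
Proof.
  intros H Hg [F1 F2]; split.
  - apply (bsum_shift k (fun n => Re (f n)) g); auto; intros n; apply H.
  - apply (bsum_shift k (fun n => Im (f n)) g); auto; intros n; apply H.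
Qed.

Lemma is_bsum_fubini (F : Z -> Z -> C) (g h : Z -> R) (r c : Z -> C) (x y : C) :
  (forall n, dominated (F n) (fun u => g n * h u)) ->
  (forall n, 0 <= g n) -> (forall u, 0 <= h u) ->
  bounded_bsum g -> bounded_bsum h ->
  (forall n, is_bsum (F n) (r n)) -> (forall u, is_bsum (fun n => F n u) (c u)) ->
  is_bsum r x -> is_bsum c y -> x = y.
Proof.
  intros HF Hg Hh Bg Bh Hr Hc [X1 X2] [Y1 Y2].
  assert (E1 : Re x = Re y).
  { apply (bsum_fubini (fun n u => Re (F n u)) g h (fun n => Re (r n)) (fun u => Re (c u)));
      auto; [intros n u; apply (HF n u)|intros n; apply (Hr n)|intros u; apply (Hc u)]. }
  assert (E2 : Im x = Im y).
  { apply (bsum_fubini (fun n u => Im (F n u)) g h (fun n => Im (r n)) (fun u => Im (c u)));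
      auto; [intros n u; apply (HF n u)|intros n; apply (Hr n)|intros u; apply (Hc u)]. }
  destruct x, y; cbn in *; congruence.
Qed.

(** * Theta constants as Gaussian series and their products *)

Lemma Cexp_plus z w : Cexp (Cplus z w) = Cmult (Cexp z) (Cexp w).
Proof.
  unfold Cexp, Cmult, Cplus, Re, Im; cbn.
  rewrite exp_plus, cos_plus, sin_plus; f_equal; ring.
Qed.

Lemma Cexp_0 : Cexp (0, 0) = RtoC 1.
Proof. unfold Cexp, RtoC, Re, Im; cbn; rewrite exp_0, cos_0, sin_0; f_equal; ring. Qed.

Lemma Cexp_bound z : Rabs (Re (Cexp z)) <= exp (Re z) /\ Rabs (Im (Cexp z)) <= exp (Re z).
Proof.
  unfold Cexp; cbn; rewrite !Rabs_mult, (Rabs_pos_eq (exp _)) by apply Rlt_le, exp_pos.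
  assert (H := exp_pos (Re z)).
  split; rewrite <- Rmult_1_r; apply Rmult_le_compat_l; try lra; apply Rabs_le.
  - apply COS_bound.
  - apply SIN_bound.
Qed.

(* [gterm tau s x b] is exp (i s x^2 tau + i pi x b). *)
Definition gterm (tau : C) (s x b : R) : C :=
  Cexp (- (s * Im tau) * x ^ 2, s * Re tau * x ^ 2 + PI * x * b).

Lemma theta_term_gterm e e' tau n :
  theta_term e e' tau n = gterm tau PI (IZR n + e / 2) e'.
Proof.
  unfold theta_term, gterm; f_equal.
  destruct tau as [x y]; unfold Cmult, Cplus, RtoC, Ci, Re, Im; cbn.
  f_equal; field.
Qed.

(* The orthogonal change of variables [u = x + y], [v = x - y]. *)
Lemma gterm_mul tau s x y a d :
  Cmult (gterm tau s x (a + d)) (gterm tau s y (a - d)) =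
  Cmult (gterm tau (s / 2) (x + y) a) (gterm tau (s / 2) (x - y) d).
Proof.
  unfold gterm; rewrite <- !Cexp_plus; f_equal; unfold Cplus; cbn; f_equal; field.
Qed.

Lemma gterm_bound tau s x b :
  Rabs (Re (gterm tau s x b)) <= exp (- (s * Im tau) * x ^ 2) /\
  Rabs (Im (gterm tau s x b)) <= exp (- (s * Im tau) * x ^ 2).
Proof. apply Cexp_bound. Qed.

Lemma theta_partial_bsum e e' tau N :
  theta_partial e e' tau N =
  (bsum (fun n => Re (theta_term e e' tau n)) N,
   bsum (fun n => Im (theta_term e e' tau n)) N).
Proof.
  unfold theta_partial; generalize (theta_term e e' tau); intros f.
  induction N as [|N IH].
  - cbn [Nat.mul bsum]; rewrite sum_O; cbn; now destruct (f 0%Z).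
  - replace (2 * S N)%nat with (S (S (2 * N))) by lia.
    (* Of the indices [0, ..., 2 * N + 2] the last and the first are split off; the others, lowered
       by one, form the partial sum for [N]. *)
    rewrite sum_Sn; unfold sum_n; rewrite sum_Sn_m by lia.
    rewrite <- sum_n_m_S.
    rewrite (sum_n_m_ext _ (fun j => f (Z.of_nat j - Z.of_nat N)%Z)).
    2: { intros j; f_equal; lia. }
    unfold sum_n in IH; rewrite IH; cbn [bsum].
    replace (Z.of_nat 0 - Z.of_nat (S N))%Z with (- Z.of_nat (S N))%Z by lia.
    replace (Z.of_nat (S (S (2 * N))) - Z.of_nat (S N))%Z with (Z.of_nat (S N)) by lia.
    unfold plus; cbn -[Z.of_nat]; unfold Cplus; cbn -[Z.of_nat]; unfold Re, Im; f_equal; ring.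
Qed.

Lemma gterm_dominated tau s h b :
  dominated (fun n => gterm tau s (IZR n + h) b)
            (fun n => exp (- (s * Im tau) * (IZR n + h) ^ 2)).
Proof. intros n; apply gterm_bound. Qed.

Lemma theta_const_is_bsum e e' tau : 0 < Im tau ->
  is_bsum (fun n => gterm tau PI (IZR n + e / 2) e') (theta_const e e' tau).
Proof.
  intros Ht.
  enough (H : theta_const e e' tau = btotal (fun n => gterm tau PI (IZR n + e / 2) e')).
  { rewrite H; apply (dominated_is_bsum _ _ (gterm_dominated tau PI (e / 2) e')).
    apply bounded_bsum_gauss, Rmult_lt_0_compat; [apply PI_RGT_0|exact Ht]. }
  unfold theta_const, btotal; f_equal; f_equal; apply Lim_seq_ext; intros N;
    rewrite theta_partial_bsum.
  - apply (bsum_ext (fun n => Re (theta_term e e' tau n))); intros n.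
    now rewrite theta_term_gterm.
  - apply (bsum_ext (fun n => Im (theta_term e e' tau n))); intros n.
    now rewrite theta_term_gterm.
Qed.

(** For [u = 2 * w] or [u = 2 * w + 1] one has [2 * n - u = 2 * (n - w) + j] with [j = 0] or
    [j = -1]. Invariance under the shift by [- w] makes the sum over [n] depend on [u] only through
    its parity. *)
Lemma gterm_even_shift_is_bsum tau s j b (k : Z) : 0 < s * Im tau ->
  is_bsum (fun n => gterm tau s (2 * IZR (n + k) + j) b)
          (btotal (fun n => gterm tau s (2 * IZR n + j) b)).
Proof.
  intros Hs.
  set (f := fun n : Z => gterm tau s (2 * IZR n + j) b).
  set (g := fun n : Z => exp (- (4 * (s * Im tau)) * (IZR n + j / 2) ^ 2)).
  assert (D : dominated f g).
  { intros n; unfold f, g.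
    replace (- (4 * (s * Im tau)) * (IZR n + j / 2) ^ 2)
      with (- (s * Im tau) * (2 * IZR n + j) ^ 2) by field.
    apply gterm_bound. }
  assert (B : bounded_bsum g) by (apply bounded_bsum_gauss; lra).
  exact (is_bsum_shift k f g _ D B (dominated_is_bsum f g D B)).
Qed.

(* Grouping the double series for the product by [u = n + m] and [v = n - m] leaves only the
   condition that u and v have the same parity, whence a sum of two decoupled products. *)
Lemma theta_const_mul_rank2 e tau : 0 < Im tau ->
  exists A0 A1 D0 D1 : R -> C, forall a d : R,
  Cmult (theta_const e (a + d) tau) (theta_const e (a - d) tau) =
  Cplus (Cmult (A0 a) (D0 d)) (Cmult (A1 a) (D1 d)).
Proof.
  intros Ht.
  assert (Hpi := PI_RGT_0).
  assert (Hs : 0 < PI / 2 * Im tau) by (apply Rmult_lt_0_compat; lra).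
  set (gA := fun u : Z => exp (- (PI / 2 * Im tau) * (IZR u + e) ^ 2)).
  assert (BA : bounded_bsum gA) by now apply bounded_bsum_gauss.
  (* A parity class is cut out by zeros, so that the sum over [u] still runs through all
     integers. *)
  set (A := fun (p : Z -> bool) a u =>
    if p u then gterm tau (PI / 2) (IZR u + e) a else RtoC 0).
  assert (HA : forall p a, is_bsum (A p a) (btotal (A p a))).
  { intros p a; apply dominated_is_bsum with gA; [|exact BA].
    intros u; unfold A; destruct (p u); [apply gterm_bound|].
    cbn; rewrite Rabs_R0; split; apply Rlt_le, exp_pos. }
  set (D := fun j d => btotal (fun n => gterm tau (PI / 2) (2 * IZR n + j) d)).
  exists (fun a => btotal (A Z.even a)), (fun a => btotal (A Z.odd a)), (D 0), (D (-1));
    intros a d.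
  (* The second summation index is [m = u - n]; the offsets [e / 2] add up to [e] in the sum of the
     arguments and cancel in the difference. *)
  set (F := fun n u : Z =>
    Cmult (gterm tau PI (IZR n + e / 2) (a + d)) (gterm tau PI (IZR (u - n) + e / 2) (a - d))).
  assert (FE : forall n u, F n u =
    Cmult (gterm tau (PI / 2) (IZR u + e) a) (gterm tau (PI / 2) (2 * IZR n - IZR u) d)).
  { intros n u; unfold F; rewrite gterm_mul, minus_IZR; f_equal; f_equal; field. }
  set (c := PI * Im tau / 3).
  assert (Hc : 0 < c) by (unfold c; nra).
  apply (is_bsum_fubini F
    (fun n => exp (- c * (IZR n + e / 2) ^ 2)) (fun u => exp (- c * (IZR u + e) ^ 2))
    (fun n => Cmult (gterm tau PI (IZR n + e / 2) (a + d)) (theta_const e (a - d) tau))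
    (fun u => Cmult (gterm tau (PI / 2) (IZR u + e) a) (if Z.even u then D 0 d else D (-1) d))).
  - intros n u; unfold F, gterm.
    rewrite <- Cexp_plus, <- exp_plus.
    (* positive definiteness: x^2 + (u - x)^2 >= (x^2 + u^2) / 3 *)
    match goal with |- Rabs (Re (Cexp ?z)) <= exp ?r /\ _ =>
      assert (HB := Cexp_bound z); assert (HR : exp (Re z) <= exp r) end.
    { apply exp_le_compat; cbn -[pow]; rewrite minus_IZR; unfold c.
      set (x := IZR n + e / 2); set (w := IZR u + e).
      replace (IZR u - IZR n + e / 2) with (w - x) by (unfold x, w; field).
      assert (0 <= 5 / 3 * x ^ 2 - 2 * x * w + 2 / 3 * w ^ 2).
      { replace (5 / 3 * x ^ 2 - 2 * x * w + 2 / 3 * w ^ 2)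
          with (2 / 3 * (w - 3 / 2 * x) ^ 2 + 1 / 6 * x ^ 2) by field.
        assert (H1 := pow2_ge_0 x); assert (H2 := pow2_ge_0 (w - 3 / 2 * x)); lra. }
      assert (0 <= PI * Im tau) by nra.
      nra. }
    lra.
  - intros n; apply Rlt_le, exp_pos.
  - intros n; apply Rlt_le, exp_pos.
  - now apply bounded_bsum_gauss.
  - now apply bounded_bsum_gauss.
  - intros n; apply is_bsum_scal.
    apply (is_bsum_shift (- n) (fun m => gterm tau PI (IZR m + e / 2) (a - d)) _ _
      (gterm_dominated tau PI (e / 2) (a - d))).
    + apply bounded_bsum_gauss; lra.
    + now apply theta_const_is_bsum.
  - intros u; eapply is_bsum_ext; [intros n; symmetry; apply FE|].
    apply is_bsum_scal.
    destruct (Z.even u) eqn:Eu.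
    + apply Z.even_spec in Eu; destruct Eu as [w ->].
      eapply is_bsum_ext; [|apply (gterm_even_shift_is_bsum _ _ 0 d (- w)%Z Hs)].
      intros n; cbn beta; f_equal; rewrite plus_IZR, opp_IZR, mult_IZR; ring.
    + assert (Ou : Z.odd u = true) by (rewrite <- Z.negb_even, Eu; reflexivity).
      apply Z.odd_spec in Ou; destruct Ou as [w ->].
      eapply is_bsum_ext; [|apply (gterm_even_shift_is_bsum _ _ (-1) d (- w)%Z Hs)].
      intros n; cbn beta; f_equal; rewrite !plus_IZR, opp_IZR, mult_IZR; ring.
  - eapply is_bsum_ext; [intros n; apply Cmult_comm|].
    rewrite Cmult_comm; apply is_bsum_scal; now apply theta_const_is_bsum.
  - rewrite 2!(Cmult_comm (btotal _)).
    eapply is_bsum_ext;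
      [|exact (is_bsum_plus _ _ _ _ (is_bsum_scal (D 0 d) _ _ (HA Z.even a))
                                    (is_bsum_scal (D (-1) d) _ _ (HA Z.odd a)))].
    intros u; unfold A; rewrite <- Z.negb_even; destruct (Z.even u); cbn [negb]; ring.
Qed.

(** * Quasi-periodicity in the second characteristic *)

Lemma Cexp_2PI n : Cexp (0, 2 * IZR n * PI) = RtoC 1.
Proof.
  unfold Cexp, RtoC; cbn [Re Im fst snd]; rewrite exp_0.
  enough (H : cos (2 * IZR n * PI) = 1 /\ sin (2 * IZR n * PI) = 0)
    by (destruct H as [-> ->]; f_equal; ring).
  assert (P : forall k : nat, cos (2 * INR k * PI) = 1 /\ sin (2 * INR k * PI) = 0).
  { intros k; rewrite <- (Rplus_0_l (2 * INR k * PI)), cos_period, sin_period.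
    split; [apply cos_0|apply sin_0]. }
  destruct n as [|p|p].
  - rewrite Rmult_0_r, Rmult_0_l; split; [apply cos_0|apply sin_0].
  - rewrite <- (positive_nat_Z p), <- INR_IZR_INZ; apply P.
  - rewrite <- Pos2Z.opp_pos, opp_IZR, <- (positive_nat_Z p), <- INR_IZR_INZ.
    destruct (P (Pos.to_nat p)) as [Hc Hs].
    replace (2 * - INR (Pos.to_nat p) * PI) with (- (2 * INR (Pos.to_nat p) * PI)) by ring.
    rewrite cos_neg, sin_neg, Hc, Hs; split; ring.
Qed.

(** The term of index [n] acquires the phase [2 * PI * (n + e / 2)], whose part [2 * PI * n] is
    invisible to the exponential. *)
Lemma theta_const_add2 e e' tau : 0 < Im tau ->
  theta_const e (e' + 2) tau = Cmult (Cexp (0, PI * e)) (theta_const e e' tau).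
Proof.
  intros Ht.
  apply (is_bsum_unique (fun n => gterm tau PI (IZR n + e / 2) (e' + 2))).
  - now apply theta_const_is_bsum.
  - eapply is_bsum_ext; [|apply is_bsum_scal, (theta_const_is_bsum e e' tau Ht)].
    intros n; unfold gterm; cbn beta; rewrite <- Cexp_plus.
    rewrite <- (Cmult_1_l (Cexp (Cplus _ _))), <- (Cexp_2PI n), <- Cexp_plus.
    f_equal; unfold Cplus; cbn -[pow]; f_equal; field.
Qed.

(** * Polynomial functions of four variables and their coefficient arrays *)

Inductive polyfun : (C -> C -> C -> C -> C) -> Prop :=
  | polyfun_const c : polyfun (fun _ _ _ _ => c)
  | polyfun_1 : polyfun (fun x _ _ _ => x)
  | polyfun_2 : polyfun (fun _ x _ _ => x)
  | polyfun_3 : polyfun (fun _ _ x _ => x)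
  | polyfun_4 : polyfun (fun _ _ _ x => x)
  | polyfun_plus p q : polyfun p -> polyfun q ->
      polyfun (fun x y z w => Cplus (p x y z w) (q x y z w))
  | polyfun_mult p q : polyfun p -> polyfun q ->
      polyfun (fun x y z w => Cmult (p x y z w) (q x y z w)).

Lemma polyfun_comp p q1 q2 q3 q4 :
  polyfun p -> polyfun q1 -> polyfun q2 -> polyfun q3 -> polyfun q4 ->
  polyfun (fun x y z w => p (q1 x y z w) (q2 x y z w) (q3 x y z w) (q4 x y z w)).
Proof.
  intros Hp H1 H2 H3 H4; induction Hp; try assumption.
  - apply polyfun_const.
  - now apply (polyfun_plus _ _ IHHp1 IHHp2).
  - now apply (polyfun_mult _ _ IHHp1 IHHp2).
Qed.

Definition monomial := (C * (nat * nat * nat * nat))%type.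

Definition monomial_eval (x y z w : C) (m : monomial) : C :=
  let '(k, (a, b, g, h)) := m in
  Cmult k (Cmult (Cmult (pow_n x a) (pow_n y b)) (Cmult (pow_n z g) (pow_n w h))).

Fixpoint monomials_eval (x y z w : C) (l : list monomial) : C :=
  match l with
  | nil => RtoC 0
  | m :: l' => Cplus (monomial_eval x y z w m) (monomials_eval x y z w l')
  end.

Definition monomial_mul (m n : monomial) : monomial :=
  let '(k, (a, b, g, h)) := m in let '(k', (a', b', g', h')) := n in
  (Cmult k k', (a + a', b + b', g + g', h + h')%nat).

Lemma monomial_eval_mul x y z w m n :
  monomial_eval x y z w (monomial_mul m n) =
  Cmult (monomial_eval x y z w m) (monomial_eval x y z w n).
Proof.
  destruct m as [k [[[a b] g] h]], n as [k' [[[a' b'] g'] h']]; cbn -[pow_n].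
  rewrite !pow_n_plus; unfold mult; cbn -[pow_n]; ring.
Qed.

Lemma monomials_eval_app x y z w l l' :
  monomials_eval x y z w (l ++ l') =
  Cplus (monomials_eval x y z w l) (monomials_eval x y z w l').
Proof.
  induction l as [|m l IH]; cbn [app monomials_eval]; [ring|rewrite IH; ring].
Qed.

Lemma monomials_eval_mul x y z w l l' :
  monomials_eval x y z w (flat_map (fun m => map (monomial_mul m) l') l) =
  Cmult (monomials_eval x y z w l) (monomials_eval x y z w l').
Proof.
  induction l as [|m l IH]; cbn [flat_map monomials_eval]; [ring|].
  rewrite monomials_eval_app, IH.
  enough (H : monomials_eval x y z w (map (monomial_mul m) l') =
              Cmult (monomial_eval x y z w m) (monomials_eval x y z w l'))
    by (rewrite H; ring).
  clear; induction l' as [|n l' IH]; cbn [map monomials_eval]; [ring|].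
  rewrite IH, monomial_eval_mul; ring.
Qed.

(** Lists may repeat exponents, so sums are concatenations and products run over all pairs, without
    collecting like terms. *)
Lemma polyfun_monomials p : polyfun p ->
  exists l, forall x y z w, p x y z w = monomials_eval x y z w l.
Proof.
  induction 1 as [c| | | | |p q _ [l Hl] _ [l' Hl']|p q _ [l Hl] _ [l' Hl']].
  - exists ((c, (0, 0, 0, 0)%nat) :: nil); intros; cbn; unfold one; cbn; ring.
  - exists ((RtoC 1, (1, 0, 0, 0)%nat) :: nil); intros; cbn; unfold one, mult; cbn; ring.
  - exists ((RtoC 1, (0, 1, 0, 0)%nat) :: nil); intros; cbn; unfold one, mult; cbn; ring.
  - exists ((RtoC 1, (0, 0, 1, 0)%nat) :: nil); intros; cbn; unfold one, mult; cbn; ring.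
  - exists ((RtoC 1, (0, 0, 0, 1)%nat) :: nil); intros; cbn; unfold one, mult; cbn; ring.
  - exists (l ++ l'); intros; now rewrite monomials_eval_app, Hl, Hl'.
  - exists (flat_map (fun m => map (monomial_mul m) l') l); intros.
    now rewrite monomials_eval_mul, Hl, Hl'.
Qed.

Lemma sum_n_zero (u : nat -> C) d : (forall i, (i <= d)%nat -> u i = RtoC 0) ->
  sum_n u d = RtoC 0.
Proof.
  intros H; induction d as [|d IH].
  - rewrite sum_O; auto.
  - rewrite sum_Sn, IH, H by auto; unfold plus; cbn; ring.
Qed.

Lemma sum_n_delta (u : nat -> C) i d : (i <= d)%nat ->
  (forall j, j <> i -> u j = RtoC 0) -> sum_n u d = u i.
Proof.
  intros Hi H; induction d as [|d IH].
  - rewrite sum_O; f_equal; lia.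
  - rewrite sum_Sn; destruct (Nat.eq_dec i (S d)) as [->|Hd].
    + rewrite sum_n_zero; [unfold plus; cbn; ring|].
      intros j Hj; apply H; lia.
    + rewrite IH by lia; rewrite (H (S d)) by lia; unfold plus; cbn; ring.
Qed.

Lemma poly4_eval_plus d c c' x y z w :
  poly4_eval d (fun a b g h => Cplus (c a b g h) (c' a b g h)) x y z w =
  Cplus (poly4_eval d c x y z w) (poly4_eval d c' x y z w).
Proof.
  unfold poly4_eval; change Cplus with (@plus C_AbelianMonoid).
  do 4 (rewrite <- sum_n_plus; apply sum_n_ext; intros ?).
  unfold plus; cbn -[pow_n]; ring.
Qed.

Definition monomial_coef (m : monomial) (a b g h : nat) : C :=
  let '(k, (a', b', g', h')) := m in
  if (Nat.eqb a a' && Nat.eqb b b' && Nat.eqb g g' && Nat.eqb h h')%bool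
  then k else RtoC 0.

Definition monomial_bound (d : nat) (m : monomial) : Prop :=
  let '(k, (a, b, g, h)) := m in (a <= d /\ b <= d /\ g <= d /\ h <= d)%nat.

Lemma poly4_eval_monomial d m x y z w : monomial_bound d m ->
  poly4_eval d (monomial_coef m) x y z w = monomial_eval x y z w m.
Proof.
  destruct m as [k [[[a b] g] h]]; intros (Ha & Hb & Hg & Hh).
  unfold poly4_eval.
  rewrite (sum_n_delta _ a d Ha), (sum_n_delta _ b d Hb), (sum_n_delta _ g d Hg),
    (sum_n_delta _ h d Hh).
  - cbn -[pow_n]; now rewrite !Nat.eqb_refl.
  (* The side conditions come from the innermost index outwards; a wrong exponent annihilates all
     sums nested inside it. *)
  - intros j Hj; cbn -[pow_n]; apply Nat.eqb_neq in Hj.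
    rewrite Hj, !Bool.andb_false_r; ring.
  - intros j Hj; apply Nat.eqb_neq in Hj.
    apply sum_n_zero; intros; cbn -[pow_n].
    rewrite Hj, !Bool.andb_false_r; cbn -[pow_n]; ring.
  - intros j Hj; apply Nat.eqb_neq in Hj.
    do 2 (apply sum_n_zero; intros); cbn -[pow_n].
    rewrite Hj, !Bool.andb_false_r; cbn -[pow_n]; ring.
  - intros j Hj; apply Nat.eqb_neq in Hj.
    do 3 (apply sum_n_zero; intros); cbn -[pow_n].
    rewrite Hj; cbn -[pow_n]; ring.
Qed.

Lemma monomials_bound (l : list monomial) : exists d, List.Forall (monomial_bound d) l.
Proof.
  induction l as [|[k [[[a b] g] h]] l [d Hd]]; [exists 0%nat; constructor|].
  exists (a + b + g + h + d)%nat; constructor; [cbn; lia|].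
  eapply List.Forall_impl; [|exact Hd]; intros [k' [[[a' b'] g'] h']]; cbn; lia.
Qed.

Lemma polyfun_poly4_eval p : polyfun p ->
  exists d c, forall x y z w, p x y z w = poly4_eval d c x y z w.
Proof.
  intros Hp; destruct (polyfun_monomials p Hp) as [l Hl].
  destruct (monomials_bound l) as [d Hd]; exists d.
  enough (H : exists c, forall x y z w, monomials_eval x y z w l = poly4_eval d c x y z w).
  { destruct H as [c Hc]; exists c; intros; now rewrite Hl. }
  clear Hl; induction Hd as [|m l Hm _ [c Hc]].
  - exists (fun _ _ _ _ => RtoC 0); intros; symmetry; unfold poly4_eval.
    do 4 (apply sum_n_zero; intros); ring.
  - exists (fun a b g h => Cplus (monomial_coef m a b g h) (c a b g h)); intros.
    rewrite poly4_eval_plus, poly4_eval_monomial by assumption; cbn; now rewrite Hc.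
Qed.

(** * Algebraic dependence and its invariance under reordering and scaling *)

(** Nontriviality is witnessed by a nonzero value instead of a nonzero coefficient, which is easy to
    carry through substitutions. *)
Definition poly_dependent4 (f1 f2 f3 f4 : C -> C) : Prop :=
  exists p, polyfun p /\ (exists x y z w, p x y z w <> RtoC 0) /\
  forall tau, 0 < Im tau -> p (f1 tau) (f2 tau) (f3 tau) (f4 tau) = RtoC 0.

(** If all coefficients up to [d] were zero, the polynomial would vanish at the witness point. *)
Lemma poly_dependent4_alg f1 f2 f3 f4 :
  poly_dependent4 f1 f2 f3 f4 -> alg_dependent4 f1 f2 f3 f4.
Proof.
  intros (p & Hp & (x & y & z & w & Hnz) & H0).
  destruct (polyfun_poly4_eval p Hp) as (d & c & Hc).
  exists d, c; split.
  - apply NNPP; intros Hno; apply Hnz; rewrite Hc; unfold poly4_eval.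
    apply sum_n_zero; intros a Ha; apply sum_n_zero; intros b Hb.
    apply sum_n_zero; intros g Hg; apply sum_n_zero; intros h Hh.
    assert (E : c a b g h = RtoC 0).
    { apply NNPP; intros Hne; apply Hno; exists a, b, g, h; auto. }
    rewrite E; ring.
  - intros tau Ht; rewrite <- Hc; auto.
Qed.

Lemma poly_dependent4_swap12 f1 f2 f3 f4 :
  poly_dependent4 f2 f1 f3 f4 -> poly_dependent4 f1 f2 f3 f4.
Proof.
  intros (p & Hp & (x & y & z & w & Hnz) & H0).
  exists (fun x y z w => p y x z w); repeat split; [|now exists y, x, z, w|auto].
  apply (polyfun_comp p _ _ _ _ Hp polyfun_2 polyfun_1 polyfun_3 polyfun_4).
Qed.

Lemma poly_dependent4_swap23 f1 f2 f3 f4 :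
  poly_dependent4 f1 f3 f2 f4 -> poly_dependent4 f1 f2 f3 f4.
Proof.
  intros (p & Hp & (x & y & z & w & Hnz) & H0).
  exists (fun x y z w => p x z y w); repeat split; [|now exists x, z, y, w|auto].
  apply (polyfun_comp p _ _ _ _ Hp polyfun_1 polyfun_3 polyfun_2 polyfun_4).
Qed.

Lemma poly_dependent4_swap34 f1 f2 f3 f4 :
  poly_dependent4 f1 f2 f4 f3 -> poly_dependent4 f1 f2 f3 f4.
Proof.
  intros (p & Hp & (x & y & z & w & Hnz) & H0).
  exists (fun x y z w => p x y w z); repeat split; [|now exists x, y, w, z|auto].
  apply (polyfun_comp p _ _ _ _ Hp polyfun_1 polyfun_2 polyfun_4 polyfun_3).
Qed.

(** The factors do not depend on [tau], so they are absorbed into the polynomial; the witness point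
    is rescaled by their inverses. *)
Lemma poly_dependent4_scal c1 c2 c3 c4 f1 f2 f3 f4 g1 g2 g3 g4 :
  c1 <> RtoC 0 -> c2 <> RtoC 0 -> c3 <> RtoC 0 -> c4 <> RtoC 0 ->
  (forall tau, 0 < Im tau -> f1 tau = Cmult c1 (g1 tau)) ->
  (forall tau, 0 < Im tau -> f2 tau = Cmult c2 (g2 tau)) ->
  (forall tau, 0 < Im tau -> f3 tau = Cmult c3 (g3 tau)) ->
  (forall tau, 0 < Im tau -> f4 tau = Cmult c4 (g4 tau)) ->
  poly_dependent4 f1 f2 f3 f4 -> poly_dependent4 g1 g2 g3 g4.
Proof.
  intros N1 N2 N3 N4 E1 E2 E3 E4 (p & Hp & (x & y & z & w & Hnz) & H0).
  exists (fun x y z w => p (Cmult c1 x) (Cmult c2 y) (Cmult c3 z) (Cmult c4 w)).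
  repeat split.
  - apply (polyfun_comp p (fun x _ _ _ => Cmult c1 x) (fun _ y _ _ => Cmult c2 y)
      (fun _ _ z _ => Cmult c3 z) (fun _ _ _ w => Cmult c4 w) Hp).
    + exact (polyfun_mult _ _ (polyfun_const c1) polyfun_1).
    + exact (polyfun_mult _ _ (polyfun_const c2) polyfun_2).
    + exact (polyfun_mult _ _ (polyfun_const c3) polyfun_3).
    + exact (polyfun_mult _ _ (polyfun_const c4) polyfun_4).
  - exists (Cmult (Cinv c1) x), (Cmult (Cinv c2) y), (Cmult (Cinv c3) z), (Cmult (Cinv c4) w).
    now rewrite !Cmult_assoc, !Cinv_r, !Cmult_1_l.
  - intros tau Ht; rewrite <- E1, <- E2, <- E3, <- E4; auto.
Qed.

(** * Elimination of one of five cyclic unknowns *)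

Section Elimination.
Local Open Scope C_scope.

(** The matrix factors as a 3x2 matrix times a 2x3 matrix; the left-hand side is its determinant
    expanded along the first row. *)
Lemma rank2_det3 (r1 r2 r3 s1 s2 s3 u1 u2 u3 v1 v2 v3 : C) :
  let m r s u v : C := r * u + s * v in
  m r1 s1 u1 v1 * (m r2 s2 u2 v2 * m r3 s3 u3 v3 - m r2 s2 u3 v3 * m r3 s3 u2 v2)
  - m r1 s1 u2 v2 * (m r2 s2 u1 v1 * m r3 s3 u3 v3 - m r2 s2 u3 v3 * m r3 s3 u1 v1)
  + m r1 s1 u3 v3 * (m r2 s2 u1 v1 * m r3 s3 u2 v2 - m r2 s2 u2 v2 * m r3 s3 u1 v1) = 0.
Proof. intros m; unfold m; ring. Qed.

(** Differences are written with the factor [RtoC (-1)] so that the expression matches the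
    constructors of [polyfun]. *)
Definition elim_poly (a b c d : C) : C :=
  let al := a * a * c + RtoC (-1) * (b * (d * d)) in
  let be := a * (b * b) + RtoC (-1) * (c * c * d) in
  let ga := b * b * b * d + RtoC (-1) * (a * (c * c * c)) in
  let de := c * (d * d * d) + RtoC (-1) * (a * a * a * b) in
  ga * (be * be * be * ga + al * al * al * de).

Lemma polyfun_elim_poly : polyfun elim_poly.
Proof.
  unfold elim_poly.
  repeat match goal with
  | |- polyfun (fun x y z w => @?p x y z w + @?q x y z w) => apply (polyfun_plus p q)
  | |- polyfun (fun x y z w => @?p x y z w * @?q x y z w) => apply (polyfun_mult p q)
  | |- _ => constructor
  end.
Qed.

(* [x0], ..., [x4] is a cyclic sequence for which the 5x3 matrix with rows
   (x_i^2, x_{i+1} x_{i-1}, x_{i+2} x_{i-2}) has rank at most 2. The minors of rows 1,2,3 and 2,3,4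
   are quadratic in [x0]; eliminating the quadratic term gives al^2 x0 = be ga, eliminating the
   linear one gives al be x0^2 = - ga de. *)
Lemma elim_poly_eq0 (x0 x1 x2 x3 x4 : C) (r s : nat -> C) (u0 u1 u2 v0 v1 v2 : C) :
  x1 * x1 = r 1%nat * u0 + s 1%nat * v0 ->
  x2 * x0 = r 1%nat * u1 + s 1%nat * v1 ->
  x3 * x4 = r 1%nat * u2 + s 1%nat * v2 ->
  x2 * x2 = r 2%nat * u0 + s 2%nat * v0 ->
  x3 * x1 = r 2%nat * u1 + s 2%nat * v1 ->
  x4 * x0 = r 2%nat * u2 + s 2%nat * v2 ->
  x3 * x3 = r 3%nat * u0 + s 3%nat * v0 ->
  x4 * x2 = r 3%nat * u1 + s 3%nat * v1 ->
  x0 * x1 = r 3%nat * u2 + s 3%nat * v2 ->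
  x4 * x4 = r 4%nat * u0 + s 4%nat * v0 ->
  x0 * x3 = r 4%nat * u1 + s 4%nat * v1 ->
  x1 * x2 = r 4%nat * u2 + s 4%nat * v2 ->
  elim_poly x1 x2 x3 x4 = 0.
Proof.
  intros E10 E11 E12 E20 E21 E22 E30 E31 E32 E40 E41 E42.
  assert (P1 := rank2_det3 (r 1%nat) (r 2%nat) (r 3%nat) (s 1%nat) (s 2%nat) (s 3%nat)
                  u0 u1 u2 v0 v1 v2).
  assert (P2 := rank2_det3 (r 2%nat) (r 3%nat) (r 4%nat) (s 2%nat) (s 3%nat) (s 4%nat)
                  u0 u1 u2 v0 v1 v2).
  cbn zeta beta in P1, P2.
  rewrite <- E10, <- E11, <- E12, <- E20, <- E21, <- E22, <- E30, <- E31, <- E32 in P1.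
  rewrite <- E20, <- E21, <- E22, <- E30, <- E31, <- E32, <- E40, <- E41, <- E42 in P2.
  unfold elim_poly; replace (RtoC (-1)) with (- (1)) by (unfold Copp, RtoC; cbn; f_equal; ring).
  set (al := x1 * x1 * x3 + _). set (be := x1 * (x2 * x2) + _).
  set (ga := x2 * x2 * x2 * x4 + _). set (de := x3 * _ + _).
  match type of P1 with ?l = _ => set (D1 := l) in * end.
  match type of P2 with ?l = _ => set (D2 := l) in * end.
  (* In powers of [x0], [D1] has the coefficients [- x2 * be], [x1 * x1 * al], [x3 * x4 * ga], and
     [D2] has [- x3 * be], [x4 * x4 * al], [x1 * x2 * ga], from degree 2 down to 0. The multipliers
     cancel degree 2 in [T1] and degree 1 in [T2]. *)
  assert (T1 : al * al * x0 - be * ga = x3 * D1 - x2 * D2) by (unfold D1, D2, al, be, ga; ring).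
  assert (T2 : al * be * (x0 * x0) + ga * de = x4 * x4 * D1 - x1 * x1 * D2)
    by (unfold D1, D2, al, be, ga, de; ring).
  rewrite P1, P2 in T1, T2.
  (* The factor [al * al * al] on the second relation produces [be * (al * al * x0) ^ 2], which a
     difference of squares removes by the first. *)
  replace (ga * (be * be * be * ga + al * al * al * de)) with
    (al * al * al * (al * be * (x0 * x0) + ga * de)
     - be * (al * al * x0 - be * ga) * (al * al * x0 + be * ga)) by ring.
  rewrite T1, T2; ring.
Qed.

(** Here [al = be = -1] and [ga = de = 1], so the value is -2. *)
Lemma elim_poly_nonzero : elim_poly 0 1 1 1 <> 0.
Proof.
  unfold elim_poly; intros H; apply (f_equal Re) in H; revert H; cbn; lra.
Qed.

End Elimination.

(* [theta_const] with the phase removed that makes it only quasi-periodic in [e']. *)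
Definition ntheta (e e' : R) (tau : C) : C :=
  Cmult (Cexp (0, - (PI * e / 2) * e')) (theta_const e e' tau).

(** * Relations between the normalized theta constants *)

Lemma ntheta_add2 e e' tau : 0 < Im tau -> ntheta e (e' + 2) tau = ntheta e e' tau.
Proof.
  intros Ht; unfold ntheta; rewrite theta_const_add2, Cmult_assoc, <- Cexp_plus by exact Ht.
  f_equal; f_equal; unfold Cplus; cbn; f_equal; field.
Qed.

(** The phases at [a + d] and [a - d] multiply to a phase in [a] alone, which is absorbed into [A0]
    and [A1]. *)
Lemma ntheta_mul_rank2 e tau : 0 < Im tau ->
  exists A0 A1 D0 D1 : R -> C, forall a d : R,
  Cmult (ntheta e (a + d) tau) (ntheta e (a - d) tau) =
  Cplus (Cmult (A0 a) (D0 d)) (Cmult (A1 a) (D1 d)).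
Proof.
  intros Ht; destruct (theta_const_mul_rank2 e tau Ht) as (A0 & A1 & D0 & D1 & H).
  exists (fun a => Cmult (Cexp (0, - (PI * e) * a)) (A0 a)),
    (fun a => Cmult (Cexp (0, - (PI * e) * a)) (A1 a)), D0, D1; intros a d.
  transitivity (Cmult (Cexp (0, - (PI * e) * a))
                  (Cmult (theta_const e (a + d) tau) (theta_const e (a - d) tau))).
  - unfold ntheta.
    replace (Cexp (0, - (PI * e) * a)) with
      (Cmult (Cexp (0, - (PI * e / 2) * (a + d))) (Cexp (0, - (PI * e / 2) * (a - d)))); [ring|].
    rewrite <- Cexp_plus; f_equal; unfold Cplus; cbn; f_equal; field.
  - rewrite H; ring.
Qed.

(** With [x_i] the value at [b + 2 * i / 5], the choice [a = b + 2 * i / 5], [d = 2 * j / 5] yields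
    [x_(i+j) * x_(i-j)], indices mod 5 by period 2. The eliminated unknown is the value at [b]. *)
Lemma ntheta_dependent e b :
  poly_dependent4 (ntheta e (b + 2 / 5)) (ntheta e (b + 4 / 5))
                  (ntheta e (b + 6 / 5)) (ntheta e (b + 8 / 5)).
Proof.
  exists elim_poly; split; [exact polyfun_elim_poly|split].
  { do 4 eexists; exact elim_poly_nonzero. }
  intros tau Ht.
  destruct (ntheta_mul_rank2 e tau Ht) as (A0 & A1 & D0 & D1 & H).
  assert (M : forall x y k a d, ntheta e x tau = ntheta e (a + d) tau ->
    ntheta e y tau = ntheta e (a - d) tau -> a = b + 2 * INR k / 5 ->
    Cmult (ntheta e x tau) (ntheta e y tau) =
    Cplus (Cmult (A0 (b + 2 * INR k / 5)) (D0 d)) (Cmult (A1 (b + 2 * INR k / 5)) (D1 d))).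
  { intros x y k a d -> -> <-; apply H. }
  (* For [i] from 1 to 4 and [j] from 0 to 2 the indices wrap around at most once, so a single
     period suffices. *)
  assert (P : forall x y, x = y \/ x = y + 2 \/ x + 2 = y ->
    ntheta e x tau = ntheta e y tau).
  { intros x y [->|[->|<-]]; [reflexivity|now apply ntheta_add2|].
    symmetry; now apply ntheta_add2. }
  apply (elim_poly_eq0 (ntheta e b tau) _ _ _ _
    (fun k => A0 (b + 2 * INR k / 5)) (fun k => A1 (b + 2 * INR k / 5))
    (D0 0) (D0 (2 / 5)) (D0 (4 / 5)) (D1 0) (D1 (2 / 5)) (D1 (4 / 5)));
  (eapply M; [| |reflexivity]; apply P; cbn [INR]; lra).
Qed.

(** The normalizing phases are nonzero constants in [tau], so [poly_dependent4_scal] removes them;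
    periodicity moves each characteristic to a convenient representative. *)
Lemma theta_dependent_mod2 e b1 b2 b3 b4 (m1 m2 m3 m4 : R) :
  m1 = b1 \/ m1 = b1 + 2 -> m2 = b2 \/ m2 = b2 + 2 ->
  m3 = b3 \/ m3 = b3 + 2 -> m4 = b4 \/ m4 = b4 + 2 ->
  poly_dependent4 (ntheta e m1) (ntheta e m2) (ntheta e m3) (ntheta e m4) ->
  poly_dependent4 (theta_const e b1) (theta_const e b2) (theta_const e b3) (theta_const e b4).
Proof.
  intros H1 H2 H3 H4.
  assert (N : forall b, Cexp (0, - (PI * e / 2) * b) <> RtoC 0).
  { intros b Hb; apply C1_nz; rewrite <- Cexp_0.
    replace (0, 0) with (Cplus (0, - (PI * e / 2) * b) (0, PI * e / 2 * b))
      by (unfold Cplus; cbn; f_equal; ring).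
    rewrite Cexp_plus, Hb; ring. }
  apply (poly_dependent4_scal (Cexp (0, - (PI * e / 2) * b1)) (Cexp (0, - (PI * e / 2) * b2))
    (Cexp (0, - (PI * e / 2) * b3)) (Cexp (0, - (PI * e / 2) * b4))); auto;
  intros tau Ht;
  [destruct H1 as [->| ->]|destruct H2 as [->| ->]
  |destruct H3 as [->| ->]|destruct H4 as [->| ->]];
  rewrite ?ntheta_add2 by exact Ht; reflexivity.
Qed.

(** * All choices of four among the five theta constants *)

(** If [j] is the omitted odd number, the others are [j + 2, j + 4, j + 6, j + 8] mod 10, period 2
    being 10 in the numerators. Rotations by [R4] bring the list into this order. *)
Lemma theta_dependent_sorted k1 k2 k3 k4 :
  In (k1 :: k2 :: k3 :: k4 :: nil)
    ((1 :: 3 :: 5 :: 7 :: nil) :: (1 :: 3 :: 5 :: 9 :: nil) :: (1 :: 3 :: 7 :: 9 :: nil)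
     :: (1 :: 5 :: 7 :: 9 :: nil) :: (3 :: 5 :: 7 :: 9 :: nil) :: nil)%nat ->
  poly_dependent4
    (theta_const (1/5) (INR k1 / 5)) (theta_const (1/5) (INR k2 / 5))
    (theta_const (1/5) (INR k3 / 5)) (theta_const (1/5) (INR k4 / 5)).
Proof.
  assert (H : forall j m1 m2 m3 m4,
    m1 = j + 2 -> m2 = j + 4 -> m3 = j + 6 -> m4 = j + 8 ->
    poly_dependent4 (ntheta (1/5) (m1 / 5)) (ntheta (1/5) (m2 / 5))
                    (ntheta (1/5) (m3 / 5)) (ntheta (1/5) (m4 / 5))).
  { intros j m1 m2 m3 m4 -> -> -> ->.
    replace ((j + 2) / 5) with (j / 5 + 2 / 5) by field.
    replace ((j + 4) / 5) with (j / 5 + 4 / 5) by field.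
    replace ((j + 6) / 5) with (j / 5 + 6 / 5) by field.
    replace ((j + 8) / 5) with (j / 5 + 8 / 5) by field.
    apply ntheta_dependent. }
  assert (R4 : forall f1 f2 f3 f4, poly_dependent4 f2 f3 f4 f1 -> poly_dependent4 f1 f2 f3 f4).
  { intros; now apply poly_dependent4_swap12, poly_dependent4_swap23, poly_dependent4_swap34. }
  intros [E|[E|[E|[E|[E|[]]]]]]; injection E; intros <- <- <- <-.
  - apply (theta_dependent_mod2 _ _ _ _ _ (11/5) (13/5) (15/5) (17/5)); cbn [INR]; try lra.
    apply (H 9); lra.
  - do 3 apply R4.
    apply (theta_dependent_mod2 _ _ _ _ _ (9/5) (11/5) (13/5) (15/5)); cbn [INR]; try lra.
    apply (H 7); lra.
  - do 2 apply R4.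
    apply (theta_dependent_mod2 _ _ _ _ _ (7/5) (9/5) (11/5) (13/5)); cbn [INR]; try lra.
    apply (H 5); lra.
  - apply R4.
    apply (theta_dependent_mod2 _ _ _ _ _ (5/5) (7/5) (9/5) (11/5)); cbn [INR]; try lra.
    apply (H 3); lra.
  - apply (theta_dependent_mod2 _ _ _ _ _ (3/5) (5/5) (7/5) (9/5)); cbn [INR]; try lra.
    apply (H 1); lra.
Qed.

(** Insertion sort by adjacent transpositions: [H3] inserts the fourth entry among three sorted
    ones, [H2] the third among two. *)
Lemma sorted4_wlog (P : nat -> nat -> nat -> nat -> Prop) :
  (forall i j k l, P j i k l -> P i j k l) ->
  (forall i j k l, P i k j l -> P i j k l) ->
  (forall i j k l, P i j l k -> P i j k l) ->
  (forall i j k l, (i < j)%nat -> (j < k)%nat -> (k < l)%nat -> P i j k l) ->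
  forall i j k l, i <> j -> i <> k -> i <> l -> j <> k -> j <> l -> k <> l -> P i j k l.
Proof.
  intros S12 S23 S34 H.
  assert (H3 : forall i j k l, (i < j)%nat -> (j < k)%nat -> i <> l -> j <> l -> k <> l ->
    P i j k l).
  { intros i j k l Hij Hjk Nil Njl Nkl.
    destruct (Nat.lt_ge_cases k l); [now apply H|apply S34].
    destruct (Nat.lt_ge_cases j l); [apply H; lia|apply S23].
    destruct (Nat.lt_ge_cases i l); [apply H; lia|apply S12; apply H; lia]. }
  assert (H2 : forall i j k l, (i < j)%nat -> i <> k -> i <> l -> j <> k -> j <> l -> k <> l ->
    P i j k l).
  { intros i j k l Hij Nik Nil Njk Njl Nkl.
    destruct (Nat.lt_ge_cases j k); [now apply H3|apply S23].
    destruct (Nat.lt_ge_cases i k); [apply H3; lia|apply S12; apply H3; lia]. }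
  intros i j k l Nij Nik Nil Njk Njl Nkl.
  destruct (Nat.lt_ge_cases i j); [now apply H2|apply S12; apply H2; lia].
Qed.

Theorem theorem7p1 :
  forall k1 k2 k3 k4 : nat,
    In k1 (1 :: 3 :: 5 :: 7 :: 9 :: nil)%nat ->
    In k2 (1 :: 3 :: 5 :: 7 :: 9 :: nil)%nat ->
    In k3 (1 :: 3 :: 5 :: 7 :: 9 :: nil)%nat ->
    In k4 (1 :: 3 :: 5 :: 7 :: 9 :: nil)%nat ->
    k1 <> k2 -> k1 <> k3 -> k1 <> k4 -> k2 <> k3 -> k2 <> k4 -> k3 <> k4 ->
    alg_dependent4
      (theta_const (1/5) (INR k1 / 5)) (theta_const (1/5) (INR k2 / 5))
      (theta_const (1/5) (INR k3 / 5)) (theta_const (1/5) (INR k4 / 5)).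
Proof.
  intros k1 k2 k3 k4 H1 H2 H3 H4 N12 N13 N14 N23 N24 N34.
  apply poly_dependent4_alg.
  set (K := (1 :: 3 :: 5 :: 7 :: 9 :: nil)%nat) in *.
  set (f := fun k => theta_const (1 / 5) (INR k / 5)).
  (* The memberships are part of the predicate, so that they are permuted together with the
     indices. *)
  refine (sorted4_wlog (fun i j k l => In i K -> In j K -> In k K -> In l K ->
    poly_dependent4 (f i) (f j) (f k) (f l)) _ _ _ _
    k1 k2 k3 k4 N12 N13 N14 N23 N24 N34 H1 H2 H3 H4).
  - intros; apply poly_dependent4_swap12; auto.
  - intros; apply poly_dependent4_swap23; auto.
  - intros; apply poly_dependent4_swap34; auto.
  - intros i j k l Hij Hjk Hkl Hi Hj Hk Hl; apply theta_dependent_sorted.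
    clear - Hij Hjk Hkl Hi Hj Hk Hl.
    (* The strict order leaves exactly the five increasing quadruples. *)
    destruct Hi as [<-|[<-|[<-|[<-|[<-|[]]]]]]; try lia;
      destruct Hj as [<-|[<-|[<-|[<-|[<-|[]]]]]]; try lia;
      destruct Hk as [<-|[<-|[<-|[<-|[<-|[]]]]]]; try lia;
      destruct Hl as [<-|[<-|[<-|[<-|[<-|[]]]]]]; try lia;
      cbn [In]; tauto.
Qed.
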